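(* $(\mathcal{M}_{\mathbb{Q}},\mathcal{T}_{pw})$ does not have Pseudo-Property $\overline{\mathbf{X}}$ of any length $m\geq 1$ with respect to $(\mathcal{G}_{\mathbb{Q}},\mathcal{T}_{pw})$.
   Context: $\mathcal{M}_{\mathbb{Q}}$ is the monoid, under composition, of all (not necessarily strictly) increasing maps $\mathbb{Q}\to\mathbb{Q}$ with respect to the usual order, and $\mathcal{G}_{\mathbb{Q}}\subseteq\mathcal{M}_{\mathbb{Q}}$ is the group of increasing bijections $\mathbb{Q}\to\mathbb{Q}$. On either set, $\mathcal{T}_{pw}$ is the pointwise topology, i.e. the subspace topology inherited from the product topology on $\mathbb{Q}^{\mathbb{Q}}$ with each copy of $\mathbb{Q}$ discrete. Pseudo-Property $\overline{\mathbf{X}}$: let $S$ be a monoid with neutral element $1_S$ endowed with a topology $\mathcal{T}$ (not necessarily a semigroup topology), let $D\subseteq S$ be endowed with a topology $\mathcal{T}_D$, and let $m\ge 1$. Then $(S,\mathcal{T})$ has Pseudo-Property $\overline{\mathbf{X}}$ of length $m$ with respect to $(D,\mathcal{T}_D)$ if for all $s\in S$ there exist $e_s,h_s^{(1)},\dots,h_s^{(m+1)}\in S$ and $a_s^{(1)},\dots,a_s^{(m)}\in D$ such that: (i) $e_s$ is left-invertible, i.e. there is $p\in S$ with $pe_s=1_S$; (ii) $e_s s=h_s^{(m+1)}a_s^{(m)}h_s^{(m)}a_s^{(m-1)}\cdots a_s^{(1)}h_s^{(1)}$; (iii) for all $V^{(1)},\dots,V^{(m)}\in\mathcal{T}_D$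 with $a_s^{(i)}\in V^{(i)}$ there exists $U\in\mathcal{T}$ with $s\in U$ and $e_sU\subseteq h_s^{(m+1)}V^{(m)}h_s^{(m)}V^{(m-1)}\cdots V^{(1)}h_s^{(1)}$. *)

(* Defs.v *)
From HB Require Import structures.
From mathcomp Require Import all_boot all_order all_algebra.
From mathcomp Require Import boolp classical_sets functions.
From mathcomp Require Import topology.

Set Implicit Arguments.
Unset Strict Implicit.
Unset Printing Implicit Defensive.
Import Order.TTheory GRing.Theory Num.Theory.

Local Open Scope classical_set_scope.
Local Open Scope ring_scope.

(* A monoid with a topology; multiplication is not required to be continuous. *)
#[short(type="topMonoidType")]
HB.structure Definition TopMonoid :=
  {S of monoid.Monoid S & Topological S}.

(* A subset of S with a topology of its own, not necessarily the subspace one;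
   the inclusion into S is val. *)
#[short(type="subTopologicalType")]
HB.structure Definition SubTopological (S : choiceType) (P : pred S) :=
  {D of SubChoice S P D & Topological D}.

(* h^(m+1) a^(m) h^(m) a^(m-1) ... a^(1) h^(1), where h^(k) and a^(k) are the
   values at the ordinal k - 1; rev_ord puts the largest index leftmost. *)
Definition alt_word (S : monoidType) (m : nat)
    (h : 'I_m.+1 -> S) (a : 'I_m -> S) : S :=
  (h ord_max *
   \prod_(i < m) (a (rev_ord i) * h (widen_ord (leqnSn m) (rev_ord i))))%g.

Definition left_invertible (S : monoidType) (e : S) : Prop :=
  exists p : S, (p * e = 1)%g.

Definition pseudo_property_Xbar (m : nat) (S : topMonoidType)
    (P : pred S) (D : subTopologicalType P) : Prop :=
  forall s : S,
  exists (e : S) (h : 'I_m.+1 -> S) (a : 'I_m -> D),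
  [/\ left_invertible e,
      (e * s)%g = alt_word h (fun i => val (a i)) &
      forall V : 'I_m -> set D,
        (forall i, open (V i)) -> (forall i, V i (a i)) ->
        exists U : set S,
        [/\ open U, U s &
            [set (e * u)%g | u in U] `<=`
            [set alt_word h (fun i => val (v i))
               | v in [set v : 'I_m -> D | forall i, V i (v i)]]]].

Arguments pseudo_property_Xbar : clear implicits.
Arguments pseudo_property_Xbar m S {P} D.

Definition QQ : Type := {ptws rat -> discrete_topology rat}.
HB.instance Definition _ := Topological.on QQ.

Definition increasing : set QQ :=
  [set f | {homo (f : rat -> rat) : x y / x <= y}].

(* The topology of set_type is the subspace topology. *)
Definition MQ : Type := set_type increasing.
HB.instance Definition _ := Topological.on MQ.

Definition MQ_fun (f : MQ) : rat -> rat := set_val f.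
Coercion MQ_fun : MQ >-> Funclass.

Lemma MQ_homo (f : MQ) : {homo f : x y / x <= y}.
Proof. exact: (set_valP f). Qed.

Definition MQ_of (f : rat -> rat) (hf : {homo f : x y / x <= y}) : MQ :=
  exist _ (f : QQ) (mem_set (hf : increasing f)).

Lemma MQ_ext (f g : MQ) : f =1 g -> f = g.
Proof. by move=> fg; apply: val_inj; apply: funext => x; exact: fg. Qed.

Lemma MQ_comp_homo (f g : MQ) : {homo f \o g : x y / x <= y}.
Proof. by move=> x y xy; exact/MQ_homo/MQ_homo. Qed.

Lemma MQ_id_homo : {homo (idfun : rat -> rat) : x y / x <= y}.
Proof. by []. Qed.

Definition MQ_one : MQ := MQ_of MQ_id_homo.
Definition MQ_mul (f g : MQ) : MQ := MQ_of (@MQ_comp_homo f g).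

Lemma MQ_mulA : associative MQ_mul.
Proof. by move=> f g h; exact: MQ_ext. Qed.

Lemma MQ_mul1 : left_id MQ_one MQ_mul.
Proof. by move=> f; exact: MQ_ext. Qed.

Lemma MQ_mulr1 : right_id MQ_one MQ_mul.
Proof. by move=> f; exact: MQ_ext. Qed.

HB.instance Definition _ := isMonoid.Build MQ MQ_mulA MQ_mul1 MQ_mulr1.

Definition increasing_bijection : set MQ := [set f | bijective f].

Definition GQ : Type := set_type increasing_bijection.
HB.instance Definition _ := SubChoice.on GQ.
HB.instance Definition _ := Topological.on GQ.

Lemma MQ_openE (U : set MQ) :
  open U <-> exists2 O : set QQ, open O & U = [set f : MQ | O (MQ_fun f)].
Proof.
split=> [[O oO <-]|[O oO ->]]; first by exists O.
by exists O.
Qed.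

(* The topology of GQ is the one inherited directly from Q^Q. *)
Lemma GQ_openE (U : set GQ) :
  open U <->
  exists2 O : set QQ, open O & U = [set f : GQ | O (MQ_fun (val f))].
Proof.
split=> [[_ [O oO <-] <-]|[O oO ->]]; first by exists O.
by exists [set f : MQ | O (MQ_fun f)] => //; exists O.
Qed.

(* Main.v *)
Require Import Defs.
From HB Require Import structures.
From mathcomp Require Import all_boot all_order all_algebra.
From mathcomp Require Import boolp classical_sets functions.
From mathcomp Require Import topology.

(** Being unbounded above is the obstruction.  By monotonicity, a composite of
    increasing maps of Q is unbounded above exactly when all of its factors are
    ([unbounded_mul]).  In a word alternating between fixed maps and
    bijections, the bijections are unbounded above in any case, so whether the
    word is unbounded above does not depend on them ([unbounded_alt_word]).
    This also disposes of the left-invertible factor e: composing with a left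
    inverse p only changes the leftmost fixed map.

    A basic neighbourhood in the pointwise topology controls finitely many
    values, so the maps that are unbounded above are dense ([dense_unbounded]).
    Now let s be constant.  Any neighbourhood of s contains some u that is
    unbounded above.  If e u is a word with the same fixed maps as e s, then
    u = p e u being unbounded above forces s = p e s to be so too, a
    contradiction.  The neighbourhoods prescribed for the bijections can be
    taken to be the whole group. *)

Import Order.TTheory GRing.Theory Num.Theory.
Local Open Scope classical_set_scope.
Local Open Scope ring_scope.

Definition unbounded_above (f : MQ) : Prop := forall y, exists x, y <= f x.

(** If g x <= y for all x, then f \o g is bounded by f y. *)
Lemma unbounded_mul (f g : MQ) :
  unbounded_above (f * g)%g <-> unbounded_above f /\ unbounded_above g.
Proof.
split=> [ufg|[uf ug] y]; last first.
  have [x yx] := uf y; have [z xz] := ug x.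
  by exists z; apply: le_trans yx _; exact: MQ_homo.
split=> y; first by have [x yx] := ufg y; exists (g x).
apply: contrapT => nug; have [x] := ufg (f y + 1).
suff fgx : f (g x) <= f y by rewrite leNgt (le_lt_trans fgx) // ltrDl.
by apply: MQ_homo; rewrite leNgt; apply/negP => /ltW ?; apply: nug; exists x.
Qed.

Lemma unbounded_bijection (a : GQ) : unbounded_above (val a).
Proof. by have [b _ abK] := set_valP a => y; exists (b y); rewrite abK. Qed.

Lemma unbounded_alt_word (m : nat) (h : 'I_m.+1 -> MQ) (a b : 'I_m -> GQ) :
  unbounded_above (alt_word h (fun i => val (a i))) ->
  unbounded_above (alt_word h (fun i => val (b i))).
Proof.
move=> /unbounded_mul[uh ua]; apply/unbounded_mul; split=> //; move: ua.
(* The implication between factors is itself compatible with products. *)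
apply: (big_ind2 (fun f g => unbounded_above f -> unbounded_above g)) => //.
  move=> f f' g g' ff' gg' /unbounded_mul[uf ug].
  by apply/unbounded_mul; split; [exact: ff'|exact: gg'].
move=> i _ /unbounded_mul[_ uhi]; apply/unbounded_mul; split=> //.
exact: unbounded_bijection.
Qed.

Lemma eventually_eq_cvg (u : nat -> QQ) (s : QQ) :
  (forall x, \forall n \near \oo, u n x = s x) -> u @ \oo --> s.
Proof.
move=> us; apply/cvg_sup => x A.
rewrite /= (@nbhsE (initial_topology (fun f : QQ => f x))) => -[_ [[C _ <-] Cs] CA].
by apply: filterS (us x) => n unx; apply: CA; rewrite /= unx.
Qed.

Definition unbounded_tail (n : nat) (s : MQ) (x : rat) : rat :=
  if x <= n%:R then s x else Num.max (s x) x.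

Lemma unbounded_tail_homo (n : nat) (s : MQ) :
  {homo unbounded_tail n s : x y / x <= y}.
Proof.
move=> x y xy; rewrite /unbounded_tail; case: (leP y) => yn.
  by rewrite (le_trans xy yn) MQ_homo.
case: ifP => _; first by rewrite le_max MQ_homo.
by rewrite ge_max !le_max xy orbT MQ_homo.
Qed.

(** The maps unbounded_tail n s are unbounded above and converge pointwise to s
    as n grows. *)
Lemma dense_unbounded : dense [set f : MQ | unbounded_above f].
Proof.
move=> U [s Us] oU; have /MQ_openE[O oO UO] := oU.
pose u n : MQ := MQ_of (@unbounded_tail_homo n s).
have Os : nbhs (MQ_fun s : QQ) O by apply: open_nbhs_nbhs; move: Us; rewrite UO.
have u_s : (fun n => MQ_fun (u n) : QQ) @ \oo --> (MQ_fun s : QQ).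
  apply: eventually_eq_cvg => x; exists (Num.bound `|x|) => // n /= xn.
  rewrite -[LHS]/(unbounded_tail n s x) /unbounded_tail ifT //.
  apply: le_trans (ler_norm x) _; apply: le_trans (ltW (archi_boundP _)) _ => //.
  by rewrite ler_nat.
have [n _ On] := u_s _ Os.
exists (u n); split; first by rewrite UO; exact: On n (leqnn n).
move=> y; pose x : rat := Num.max y (n%:R + 1); exists x.
rewrite -[leRHS]/(unbounded_tail n s x) /unbounded_tail ifF; first by rewrite !le_max lexx orbT.
by apply/negbTE; rewrite -ltNge lt_max ltrDl ltr01 orbT.
Qed.

Theorem mainTheorem3 (m : nat) (hm : (1 <= m)%N) :
  ~ pseudo_property_Xbar m MQ GQ.
Proof.
have s0_homo : {homo (fun _ : rat => 0 : rat) : x y / x <= y} by [].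
pose s0 := MQ_of s0_homo.
move=> /(_ s0)[e [h [a [[p pe] es Vs]]]].
have [//|//|U [oU Us UV]] := Vs (fun=> setT); first by move=> _; exact: openT.
have [u [Uu uu]] : U `&` [set f | unbounded_above f] !=set0.
  by apply: dense_unbounded oU; exists s0.
have [v _ vE] := UV _ (imageP _ Uu).
have /unbounded_mul[up] : unbounded_above (p * (e * u))%g.
  by rewrite mulgA pe mul1g.
rewrite -vE => /(@unbounded_alt_word _ _ _ a); rewrite -es => ues.
have : unbounded_above (p * (e * s0))%g by apply/unbounded_mul.
by rewrite mulgA pe mul1g => /(_ 1)[x]; rewrite /MQ_fun/= ler10.
Qed.
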